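(* Let $M\in\mathbb{N}_+$, let $\{(A_i,B_i)\in\mathbb{R}^{n\times n}\times\mathbb{R}^{n\times m} : i\in\langle M\rangle\}$ be given, and let $T\in\mathbb{N}$. (Mod-Ind) Suppose there exist symmetric positive definite matrices $\bar P_{\hat w}\in\mathbb{R}^{n\times n}$ and matrices $\bar K_{\hat w}\in\mathbb{R}^{m\times n}$, for $\hat w\in\mathcal{W}(M,T)$, such that $$\begin{bmatrix}\bar P_{\hat w} & \bar P_{\hat w}A_i^\top+\bar K_{\hat w}^\top B_i^\top\\ A_i\bar P_{\hat w}+B_i\bar K_{\hat w} & \bar P_{(\hat w,i)}\end{bmatrix}\succ0\quad\text{for all }\hat w\in\mathcal{W}(M,T-1),\ i\in\langle M\rangle,$$ $$\begin{bmatrix}\bar P_{\hat w} & \bar P_{\hat w}A_i^\top+\bar K_{\hat w}^\top B_i^\top\\ A_i\bar P_{\hat w}+B_i\bar K_{\hat w} & \bar P_{\epsilon}\end{bmatrix}\succ0\quad\text{for all }\hat w\in\langle M\rangle^T,\ i\in\langle M\rangle.$$ Put $P_{\hat w}=\bar P_{\hat w}^{-1}$ and $K_{\hat w}=\bar K_{\hat w}\bar P_{\hat w}^{-1}$, and let $\kappa:\mathbb{R}^n\to\mathcal{W}(M,T)$ be any homogeneous of degree $0$ function with $\kappa(x)\in\arg\min_{\hat w\in\mathcal{W}(M,T)}\{x^\top P_{\hat w}x\}$ for all $x\in\mathbb{R}^n$. Then, with $\Phi(x):=K_{\kappa(x)}x$, the difference inclusion $$x(k+1)\in\{A_ix(k)+B_i\Phi(x(k))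 : i\in\langle M\rangle\}$$ is uniformly exponentially stable. (Mod-Dep) Suppose there exist symmetric positive definite matrices $\bar P_{\hat w}\in\mathbb{R}^{n\times n}$, for $\hat w\in\mathcal{W}(M,T)$, and matrices $\bar K_{\hat w,i}\in\mathbb{R}^{m\times n}$, for $\hat w\in\mathcal{W}(M,T)$, $i\in\langle M\rangle$, such that $$\begin{bmatrix}\bar P_{\hat w} & \bar P_{\hat w}A_i^\top+\bar K_{\hat w,i}^\top B_i^\top\\ A_i\bar P_{\hat w}+B_i\bar K_{\hat w,i} & \bar P_{(\hat w,i)}\end{bmatrix}\succ0\quad\text{for all }\hat w\in\mathcal{W}(M,T-1),\ i\in\langle M\rangle,$$ $$\begin{bmatrix}\bar P_{\hat w} & \bar P_{\hat w}A_i^\top+\bar K_{\hat w,i}^\top B_i^\top\\ A_i\bar P_{\hat w}+B_i\bar K_{\hat w,i} & \bar P_{\epsilon}\end{bmatrix}\succ0\quad\text{for all }\hat w\in\langle M\rangle^T,\ i\in\langle M\rangle.$$ Put $P_{\hat w}=\bar P_{\hat w}^{-1}$ and $K_{\hat w,i}=\bar K_{\hat w,i}\bar P_{\hat w}^{-1}$, and let $\kappa:\mathbb{R}^n\to\mathcal{W}(M,T)$ be any homogeneous of degree $0$ function with $\kappa(x)\in\arg\min_{\hat w\in\mathcal{W}(M,T)}\{x^\top P_{\hat w}x\}$ for all $x\in\mathbb{R}^n$. Then, with $\Phi_i(x):=K_{\kappa(x),i}\,x$ for $i\in\langle M\rangle$, the difference inclusion $$x(k+1)\in\{A_ix(k)+B_i\Phi_i(x(k))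 : i\in\langle M\rangle\}$$ is uniformly exponentially stable.
   Context: $\mathbb{N}$ contains $0$; $\mathbb{N}_+=\mathbb{N}\setminus\{0\}$; $\langle M\rangle=\{1,\dots,M\}$; $|\cdot|$ is the Euclidean norm. $\langle M\rangle^k$ is the set of strings of length $k$ over $\langle M\rangle$, with $\langle M\rangle^0=\{\epsilon\}$, $\epsilon$ the empty string. $\mathcal{W}(M,T)=\bigcup_{k=0}^{T}\langle M\rangle^k$ (strings of length at most $T$), so that $\mathcal{W}(M,T-1)=\mathcal{W}(M,T)\setminus\langle M\rangle^T$ (empty when $T=0$). For a string $\hat w$ and $i\in\langle M\rangle$, $(\hat w,i)$ is the string obtained by appending $i$ at the end of $\hat w$ (so $(\epsilon,i)=i$). For symmetric matrices, $\succ 0$ means positive definite. A function $\kappa:\mathbb{R}^n\to S$ into a finite set $S$ is homogeneous of degree $0$ if $\kappa(\lambda x)=\kappa(x)$ for all $x\in\mathbb{R}^n$ and all $\lambda\in\mathbb{R}\setminus\{0\}$. For a set-valued map $F:\mathbb{R}^n\rightrightarrows\mathbb{R}^n$ with non-empty values, a solution of $x(k+1)\in F(x(k))$ from $x_0$ is a function $\phi:\mathbb{N}\to\mathbb{R}^n$ with $\phi(0)=x_0$ and $\phi(k+1)\in F(\phi(k))$ for all $k\in\mathbb{N}$. The inclusion is uniformly exponentially stable if there exist $C\ge0$ and $\gamma\in[0,1)$ such that $|\phi(k)|\le C\gamma^k|x_0|$ for all $x_0\in\mathbb{R}^n$, all solutions $\phi$ from $x_0$, and all $k\in\mathbb{N}$.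 *)

(* Defs.v *)
From HB Require Import structures.
From mathcomp Require Import all_boot all_order all_algebra.
From mathcomp Require Import classical_sets reals.

Set Implicit Arguments.
Unset Strict Implicit.
Unset Printing Implicit Defensive.

Import Order.TTheory GRing.Theory Num.Theory.
Local Open Scope classical_set_scope.
Local Open Scope ring_scope.

(* Strings over <M> are sequences over 'I_M, so W(M, T) is the finType
   T.-bseq 'I_M; W(M, T-1) and <M>^T are its elements of size < T and = T,
   and the empty string is [bseq]. *)

Fact bseq_append_subproof (S : Type) (T : nat) (w : T.-bseq S) (i : S) :
  (size w < T)%N -> (size (rcons w i) <= T)%N.
Proof. by rewrite size_rcons. Qed.

Definition bseq_append (S : Type) (T : nat) (w : T.-bseq S)
    (hw : (size w < T)%N) (i : S) : T.-bseq S :=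
  Bseq (bseq_append_subproof i hw).

Definition quad_form (R : realType) (n : nat) (P : 'M[R]_n) (x : 'cV[R]_n) : R :=
  (x^T *m P *m x) 0 0.

Definition posdefmx (R : realType) (n : nat) (P : 'M[R]_n) : Prop :=
  P \is symmetricmx /\ forall x : 'cV[R]_n, x != 0 -> 0 < quad_form P x.

(* The norm that MathComp-Analysis puts on matrices is the sup norm, hence
   this separate definition. *)
Definition enorm (R : realType) (n : nat) (x : 'cV[R]_n) : R :=
  Num.sqrt (\sum_(j < n) x j 0 ^+ 2).

Definition lmi_mx (R : realType) (n m : nat) (A : 'M[R]_n) (B : 'M[R]_(n, m))
    (P : 'M[R]_n) (K : 'M[R]_(m, n)) (Q : 'M[R]_n) : 'M[R]_(n + n) :=
  block_mx P (P *m A^T + K^T *m B^T)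
           (A *m P + B *m K) Q.

Definition homogeneous0 (R : realType) (n : nat) (S : finType)
    (kappa : 'cV[R]_n -> S) : Prop :=
  forall (x : 'cV[R]_n) (lambda : R),
    lambda != 0 -> kappa (lambda *: x) = kappa x.

Definition argmin (R : realType) (S : finType) (f : S -> R) : set S :=
  [set s | forall t, f s <= f t].

Definition is_solution (R : realType) (n : nat) (F : 'cV[R]_n -> set 'cV[R]_n)
    (x0 : 'cV[R]_n) (phi : nat -> 'cV[R]_n) : Prop :=
  phi 0%N = x0 /\ forall k : nat, F (phi k) (phi k.+1).

Definition uniformly_exponentially_stable (R : realType) (n : nat)
    (F : 'cV[R]_n -> set 'cV[R]_n) : Prop :=
  exists C gamma : R,
    [/\ 0 <= C, 0 <= gamma < 1 &
        forall (x0 : 'cV[R]_n) (phi : nat -> 'cV[R]_n),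
          is_solution F x0 phi ->
          forall k : nat, enorm (phi k) <= C * gamma ^+ k * enorm x0].

(* Main.v *)
Require Import Defs.
From mathcomp Require Import all_boot all_order all_algebra.
From mathcomp Require Import classical_sets reals.
From mathcomp Require Import boolp ring lra.

Import Order.TTheory GRing.Theory Num.Theory.
Local Open Scope classical_set_scope.
Local Open Scope ring_scope.

(** The function V(x) = min_w x^T P_w x is a common Lyapunov function. For
    w = kappa(x) and the closed-loop matrix G_{w,i}, the block inequality tested
    on (P_w x, - P_{w'} G_{w,i} x), where w' indexes its lower right block, reads
    (G_{w,i} x)^T P_{w'} (G_{w,i} x) < x^T P_w x. As w and i range over finite
    sets, the decrease of V along solutions is by a uniform factor rho < 1, and V
    is equivalent to the squared norm. The mode-independent case is the
    mode-dependent one with gains constant in i. *)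

Section QuadForm.
Context (R : realType) (n : nat).
Implicit Types (P Q D : 'M[R]_n) (x y : 'cV[R]_n).

Lemma symmetricmxP P : reflect (P^T = P) (P \is symmetricmx).
Proof.
rewrite is_hermitianmxE expr0 scale1r map_mx_id//.
by apply: (iffP eqP) => /esym.
Qed.

Lemma quad_formB P Q x :
  quad_form (P - Q) x = quad_form P x - quad_form Q x.
Proof. by rewrite /quad_form mulmxBr mulmxBl !mxE. Qed.

Lemma quad_form_mul (p : nat) (G : 'M[R]_(p, n)) (P : 'M[R]_p) x :
  quad_form (G^T *m P *m G) x = quad_form P (G *m x).
Proof. by rewrite /quad_form trmx_mul !mulmxA. Qed.

Lemma quad_form1 x : quad_form 1%:M x = enorm x ^+ 2.
Proof.
rewrite sqr_sqrtr ?sumr_ge0// => [|j _]; last exact: sqr_ge0.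
by rewrite /quad_form mulmx1 mxE; apply: eq_bigr => j _; rewrite mxE -expr2.
Qed.

Lemma quad_form_entries P x :
  quad_form P x = \sum_i \sum_j P i j * (x i 0 * x j 0).
Proof.
rewrite /quad_form -mulmxA mxE; apply: eq_bigr => i _.
rewrite !mxE mulr_sumr; apply: eq_bigr => j _; ring.
Qed.

Lemma quad_form_ub P :
  exists2 c : R, 0 < c & forall x, quad_form P x <= c * enorm x ^+ 2.
Proof.
(* The leading 1 keeps the constant positive even when [P] is zero. *)
exists (1 + \sum_i \sum_j `|P i j|).
  by rewrite ltr_pwDl// !sumr_ge0// => i _; rewrite sumr_ge0.
move=> x; rewrite quad_form_entries mulrDl mul1r ler_wpDl ?sqr_ge0//.
rewrite mulr_suml; apply: ler_sum => i _.
rewrite mulr_suml; apply: ler_sum => j _.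
apply: le_trans (ler_norm _) _; rewrite normrM ler_wpM2l//.
have coord k : x k 0 ^+ 2 <= enorm x ^+ 2.
  rewrite [leRHS]sqr_sqrtr ?sumr_ge0// => [|l _]; last exact: sqr_ge0.
  by rewrite (bigD1 k)//= lerDl sumr_ge0// => l _; exact: sqr_ge0.
(* Both signs of the product of two coordinates are at most half the sum of their squares, hence at
   most the squared norm. *)
have := coord i; have := coord j; rewrite ler_norml => hi hj; apply/andP; split; nra.
Qed.

Lemma posdefmx_unit P : posdefmx P -> P \in unitmx.
Proof.
move=> [_ pos]; rewrite unitmxE unitfE; apply/negP => /det0P[v v0 vP].
have := pos v^T; rewrite -trmx0 (inj_eq trmx_inj) => /(_ v0).
by rewrite /quad_form trmxK vP mul0mx mxE ltxx.
Qed.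

Lemma posdefmx_inv P : posdefmx P -> posdefmx (invmx P).
Proof.
move=> posP; have uP := posdefmx_unit _ posP; have [/symmetricmxP symP pos] := posP.
have symV : (invmx P)^T = invmx P by rewrite trmx_inv symP.
split=> [|x x0]; first exact/symmetricmxP.
(* This congruence turns the form of the inverse at x into the form of [P] at P^-1 x. *)
have -> : invmx P = (invmx P)^T *m P *m invmx P by rewrite symV mulVmx// mul1mx.
rewrite quad_form_mul pos//; apply: contraNneq x0 => Px0.
by rewrite -(mul1mx x) -(mulmxV uP) -mulmxA Px0 mulmx0.
Qed.

Lemma posdefmx_ge0 P x : posdefmx P -> 0 <= quad_form P x.
Proof.
move=> [_ pos]; have [->|x0] := eqVneq x 0; last exact/ltW/pos.
by rewrite /quad_form mulmx0 mxE.
Qed.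

(** An upper bound D^-1 <= c I is equivalent to D >= c^-1 I, so the entrywise bound for the inverse
    yields coercivity without eigenvalues or compactness. *)
Lemma posdefmx_lb D : posdefmx D ->
  exists2 c : R, 0 < c & forall x, enorm x ^+ 2 <= c * quad_form D x.
Proof.
move=> posD; have uD := posdefmx_unit _ posD; have [/symmetricmxP symD pos] := posD.
have [c c0 cP] := quad_form_ub (invmx D); exists c => // x.
(* Positivity of D at x - c^-1 D^-1 x: the cross terms sum to -2 |x|^2 / c,
   and the last term is at most |x|^2 / c. *)
have := posdefmx_ge0 _ (x - c^-1 *: (invmx D *m x)) posD.
have -> : quad_form D (x - c^-1 *: (invmx D *m x)) =
    quad_form D x - c^-1 * enorm x ^+ 2 *+ 2 + c^-1 ^+ 2 * quad_form (invmx D) x.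
  rewrite -quad_form1 /quad_form mulmx1 [(_ - _)^T]linearB/=.
  rewrite [(_ *: _)^T]linearZ/= trmx_mul trmx_inv symD.
  rewrite !mulmxBl !mulmxBr -!scalemxAl -!scalemxAr !mulmxA.
  rewrite -(mulmxA _ D (invmx D)) mulmxV// mulmx1 -(mulmxA _ (invmx D) D) mulVmx// mulmx1.
  rewrite !mxE; ring.
have := cP x; set N := enorm x ^+ 2; set q := quad_form D x.
set r := quad_form _ _ => rN.
have : c^-1 ^+ 2 * r <= c^-1 * N.
  by rewrite expr2 -mulrA ler_pM2l ?invr_gt0// mulrC ler_pdivrMr// mulrC.
rewrite mulr2n => h1 h2.
rewrite -ler_pdivrMl//; lra.
Qed.

Lemma posdefmx_dominates D Q : posdefmx D ->
  exists2 c : R, 0 < c & forall x, quad_form Q x <= c * quad_form D x.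
Proof.
move=> /posdefmx_lb[c c0 cP]; have [d d0 dP] := quad_form_ub Q.
exists (d * c) => [|x]; first exact: mulr_gt0.
by rewrite (le_trans (dP x))// -mulrA ler_pM2l.
Qed.

Lemma posdefmx_dominates_unif (I : finType) (D Q : I -> 'M[R]_n) :
  (forall i, posdefmx (D i)) ->
  exists2 c : R, 0 < c &
    forall i x, quad_form (Q i) x <= c * quad_form (D i) x.
Proof.
move=> posD.
have /fin_all_exists2[c c0 cP] i := posdefmx_dominates _ (Q i) (posD i).
(* The sum dominates every c_i, and the 1 keeps it positive when [I] is empty. *)
exists (1 + \sum_i c i) => [|i x].
  by rewrite ltr_pwDl// sumr_ge0// => i _; rewrite ltW.
apply: le_trans (cP i x) _; rewrite ler_wpM2r ?posdefmx_ge0//.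
rewrite (bigD1 i)//= addrCA lerDl addr_ge0// sumr_ge0// => j _.
by rewrite ltW.
Qed.

Lemma lmi_decrease (m : nat) (A : 'M[R]_n) (B : 'M[R]_(n, m)) (K : 'M[R]_(m, n)) P Q :
  let G := A + B *m (K *m invmx P) in
  posdefmx P -> posdefmx Q -> posdefmx (lmi_mx A B P K Q) ->
  posdefmx (invmx P - G^T *m invmx Q *m G).
Proof.
move=> G posP posQ [_ posL].
have uP := posdefmx_unit _ posP; have uQ := posdefmx_unit _ posQ.
have [/symmetricmxP symP _] := posP; have [/symmetricmxP symQ _] := posQ.
split=> [|x x0].
  apply/symmetricmxP.
  by rewrite linearB/= !trmx_mul trmxK !trmx_inv symP symQ mulmxA.
rewrite quad_formB quad_form_mul.
(* For this y, z minimizes the block form over its second argument, so the value obtained is that of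
   the Schur complement of [Q]. *)
pose y := invmx P *m x; pose z := - (invmx Q *m (G *m x)).
have yx : P *m y = x by rewrite mulKVmx.
have GP : (A *m P + B *m K) = G *m P.
  by rewrite mulmxDl !mulmxA mulmxKV.
have GPt : P *m A^T + K^T *m B^T = P *m G^T.
  by rewrite -[in RHS]symP -(trmx_mul G P) -GP linearD/= !trmx_mul symP.
have /posL : col_mx y z != 0.
  apply: contraNneq x0 => /eqP; rewrite col_mx_eq0 => /andP[/eqP y0 _].
  by rewrite -yx y0 mulmx0.
rewrite /quad_form /lmi_mx GP GPt -mulmxA mul_block_col tr_col_mx mul_row_col.
rewrite -!mulmxA yx.
(* The second block of the product, G x + Q z, vanishes; only the pairing of y with the first block
   remains. *)
have -> : Q *m z = - (G *m x) by rewrite mulmxN mulKVmx.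
have Py : y^T *m P = x^T by rewrite -[P]symP -trmx_mul yx.
rewrite addrN mulmx0 addr0 mulmxDr (mulmxA y^T P) Py.
by rewrite /y /z !mulmxN !trmx_mul trmx_inv symP !mulmxA !mxE.
Qed.

End QuadForm.

(** The Lyapunov argument uses nothing about strings: any finite index set with a successor map
    [next] along which the forms decrease suffices. *)
Lemma switched_stable (R : realType) (n : nat) (S I : finType)
    (P : S -> 'M[R]_n) (G : S -> I -> 'M[R]_n) (next : S -> I -> S)
    (kappa : 'cV[R]_n -> S) :
  (forall s, posdefmx (P s)) ->
  (forall s i, posdefmx (P s - (G s i)^T *m P (next s i) *m G s i)) ->
  (forall x, argmin (fun s => quad_form (P s) x) (kappa x)) ->
  uniformly_exponentially_stable
    (fun x => [set G (kappa x) i *m x | i in [set: I]]).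
Proof.
move=> posP posD kmin.
have [a a0 aP] := @posdefmx_dominates_unif R n S P (fun=> 1%:M) posP.
(* As V is a minimum over indices, the form at one fixed index already bounds it from above. *)
have [b b0 bP] := quad_form_ub R n (P (kappa 0)).
have [d d0 dP] := @posdefmx_dominates_unif R n (S * I)%type
  (fun p => P p.1 - (G p.1 p.2)^T *m P (next p.1 p.2) *m G p.1 p.2)
  (fun p => P p.1) (fun p => posD p.1 p.2).
pose V x := quad_form (P (kappa x)) x.
(* If W is the form at the successor index after one step, adding W <= V to V <= d (V - W) gives (1
   + d) W <= d V. Unlike 1 - 1/d, this ratio is nonnegative for every d > 0. *)
pose rho := d / (1 + d).
have decr x i : V (G (kappa x) i *m x) <= rho * V x.
  (* The minimum at the new state is at most the form at the successor index. *)
  apply: le_trans (kmin _ (next (kappa x) i)) _.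
  have := posdefmx_ge0 R n _ x (posP (kappa x)).
  have := posdefmx_ge0 R n _ x (posD (kappa x) i).
  have := dP (kappa x, i) x.
  rewrite /= quad_formB quad_form_mul -/(V x) => VdW VW V0.
  by rewrite /rho mulrAC ler_pdivlMr; lra.
have rho0 : 0 <= rho by rewrite divr_ge0//; lra.
exists (Num.sqrt (a * b)), (Num.sqrt rho); split; first exact: sqrtr_ge0.
  rewrite sqrtr_ge0/= -sqrtr1 ltr_sqrt// ltr_pdivrMr; lra.
move=> x0 phi [<- phiS] k.
have Vk : V (phi k) <= rho ^+ k * V (phi 0%N).
  elim: k => [|k IHk]; first by rewrite mul1r.
  have [i _ <-] := phiS k.
  by rewrite (le_trans (decr _ i))// exprS -mulrA ler_wpM2l.
(* After squaring, the chain is |phi k|^2 <= a V(phi k) <= a rho^k V(phi 0) <= a b rho^k |phi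
   0|^2. *)
rewrite -(@ler_pXn2r _ 2)// ?nnegrE ?mulr_ge0 ?exprn_ge0 ?sqrtr_ge0//.
rewrite !exprMn exprAC (sqr_sqrtr rho0) (sqr_sqrtr (ltW (mulr_gt0 a0 b0))).
have := aP (kappa (phi k)) (phi k); rewrite quad_form1 => aV.
rewrite (le_trans aV)//.
rewrite -!mulrA ler_pM2l// (le_trans Vk)// mulrCA ler_wpM2l ?exprn_ge0//.
exact: le_trans (kmin _ (kappa 0)) (bP _).
Qed.

Lemma lmi_stable (R : realType) (n m : nat) (S I : finType)
    (A : I -> 'M[R]_n) (B : I -> 'M[R]_(n, m))
    (Pbar : S -> 'M[R]_n) (Kbar : S -> I -> 'M[R]_(m, n))
    (kappa : 'cV[R]_n -> S) :
  (forall s, posdefmx (Pbar s)) ->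
  (forall s i, exists t, posdefmx (lmi_mx (A i) (B i) (Pbar s) (Kbar s i) (Pbar t))) ->
  (forall x, argmin (fun s => quad_form (invmx (Pbar s)) x) (kappa x)) ->
  uniformly_exponentially_stable (fun x => [set A i *m x +
    B i *m (Kbar (kappa x) i *m invmx (Pbar (kappa x)) *m x) | i in [set: I]]).
Proof.
move=> posP lmi kmin.
(* Indices and modes are finite in number, so the successors that exist pointwise assemble into a
   map. *)
have /fin_all_exists[next nextP] s := fin_all_exists (lmi s).
pose G s i := A i + B i *m (Kbar s i *m invmx (Pbar s)).
have -> : (fun x => [set A i *m x +
    B i *m (Kbar (kappa x) i *m invmx (Pbar (kappa x)) *m x) | i in [set: I]]) =
    (fun x => [set G (kappa x) i *m x | i in [set: I]]).
  by apply/funext => x; apply: eq_imagel => i _; rewrite mulmxDl !mulmxA.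
apply: (switched_stable _ _ _ _ (fun s => invmx (Pbar s)) G next) => // [s|s i].
  exact: posdefmx_inv.
exact: lmi_decrease.
Qed.

Theorem corollary1 (R : realType) (n m M T : nat) (hM : (0 < M)%N)
    (A : 'I_M -> 'M[R]_n) (B : 'I_M -> 'M[R]_(n, m)) :
  (forall (Pbar : T.-bseq 'I_M -> 'M[R]_n)
          (Kbar : T.-bseq 'I_M -> 'M[R]_(m, n)),
    (forall w, posdefmx (Pbar w)) ->
    (forall (w : T.-bseq 'I_M) (hw : (size w < T)%N) (i : 'I_M),
      posdefmx
        (lmi_mx (A i) (B i) (Pbar w) (Kbar w) (Pbar (bseq_append hw i)))) ->
    (forall (w : T.-bseq 'I_M) (i : 'I_M), size w = T ->
      posdefmx (lmi_mx (A i) (B i) (Pbar w) (Kbar w) (Pbar [bseq]))) ->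
    let P := fun w => invmx (Pbar w) in
    let K := fun w => Kbar w *m invmx (Pbar w) in
    forall kappa : 'cV[R]_n -> T.-bseq 'I_M,
    homogeneous0 kappa ->
    (forall x, argmin (fun w => quad_form (P w) x) (kappa x)) ->
    let Phi := fun x => K (kappa x) *m x in
    uniformly_exponentially_stable
      (fun x => [set A i *m x + B i *m Phi x | i in [set: 'I_M]]))
  /\
  (forall (Pbar : T.-bseq 'I_M -> 'M[R]_n)
          (Kbar : T.-bseq 'I_M -> 'I_M -> 'M[R]_(m, n)),
    (forall w, posdefmx (Pbar w)) ->
    (forall (w : T.-bseq 'I_M) (hw : (size w < T)%N) (i : 'I_M),
      posdefmx
        (lmi_mx (A i) (B i) (Pbar w) (Kbar w i) (Pbar (bseq_append hw i)))) ->
    (forall (w : T.-bseq 'I_M) (i : 'I_M), size w = T ->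
      posdefmx (lmi_mx (A i) (B i) (Pbar w) (Kbar w i) (Pbar [bseq]))) ->
    let P := fun w => invmx (Pbar w) in
    let K := fun w i => Kbar w i *m invmx (Pbar w) in
    forall kappa : 'cV[R]_n -> T.-bseq 'I_M,
    homogeneous0 kappa ->
    (forall x, argmin (fun w => quad_form (P w) x) (kappa x)) ->
    let Phi := fun i x => K (kappa x) i *m x in
    uniformly_exponentially_stable
      (fun x => [set A i *m x + B i *m Phi i x | i in [set: 'I_M]])).
Proof.
have dep Pbar (Kbar : T.-bseq 'I_M -> 'I_M -> 'M[R]_(m, n)) kappa :
    (forall w, posdefmx (Pbar w)) ->
    (forall (w : T.-bseq 'I_M) (hw : (size w < T)%N) (i : 'I_M),
      posdefmx
        (lmi_mx (A i) (B i) (Pbar w) (Kbar w i) (Pbar (bseq_append hw i)))) ->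
    (forall (w : T.-bseq 'I_M) (i : 'I_M), size w = T ->
      posdefmx (lmi_mx (A i) (B i) (Pbar w) (Kbar w i) (Pbar [bseq]))) ->
    (forall x, argmin (fun w => quad_form (invmx (Pbar w)) x) (kappa x)) ->
    uniformly_exponentially_stable (fun x => [set A i *m x +
      B i *m (Kbar (kappa x) i *m invmx (Pbar (kappa x)) *m x) | i in [set: 'I_M]]).
  move=> posP lmi_lt lmi_eq; apply: lmi_stable => // w i.
  (* A string shorter than T is extended by the active mode; one of full length is reset to the
     empty string. *)
  have [wT|Tw] := ltnP (size w) T; first by exists (bseq_append wT i).
  by exists [bseq]; apply: lmi_eq; apply/eqP; rewrite eqn_leq size_bseq.
split=> [Pbar Kbar posP lmi_lt lmi_eq P K kappa _ kmin|].
  exact: (dep Pbar (fun w _ => Kbar w)).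
by move=> Pbar Kbar posP lmi_lt lmi_eq P K kappa _ kmin; apply: dep.
Qed.
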